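(* For every positive integer $n$, the number $G_1(n)$ of complete Gessel words of length $2n$ in which each of the letters $1$ and $\bar{1}$ occurs exactly once (so that each of $2$ and $\bar{2}$ occurs exactly $n-1$ times) is $$G_1(n)=\frac{2n+1}{2}\binom{2n}{n}-2^{2n-1}.$$
   Context: Words are finite sequences over the four-letter alphabet $\{1,2,\bar{1},\bar{2}\}$. For a word $x$ and a letter $\alpha$, $N_\alpha(x)$ denotes the number of occurrences of $\alpha$ in $x$. A word $w$ is a Gessel word if every prefix $x$ of $w$ satisfies $N_2(x)-N_{\bar{2}}(x)\ge 0$ and $N_2(x)+N_1(x)-N_{\bar{2}}(x)-N_{\bar{1}}(x)\ge 0$. A Gessel word $w$ is complete if in addition $N_1(w)=N_{\bar{1}}(w)$ and $N_2(w)=N_{\bar{2}}(w)$. *)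

(* Defs.v *)
From HB Require Import structures.
From mathcomp Require Import all_boot all_order all_algebra.

Set Implicit Arguments.
Unset Strict Implicit.
Unset Printing Implicit Defensive.

Import Order.TTheory GRing.Theory Num.Theory.

Local Open Scope ring_scope.

(* [L1b] and [L2b] are the barred letters. *)
Inductive letter := L1 | L2 | L1b | L2b.

(* Encoding used only to derive the finite type structure of [letter]. *)
Definition letter_code (a : letter) : bool * bool :=
  match a with
  | L1 => (false, false) | L2 => (true, false)
  | L1b => (false, true) | L2b => (true, true)
  end.

Definition letter_decode (c : bool * bool) : letter :=
  match c with
  | (false, false) => L1 | (true, false) => L2
  | (false, true) => L1b | (true, true) => L2b
  end.

Lemma letter_codeK : cancel letter_code letter_decode.
Proof. by case. Qed.

HB.instance Definition _ := Finite.copy letter (can_type letter_codeK).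

(* Integer valued, so that the differences below are not truncated. *)
Definition N (a : letter) (x : seq letter) : int := (count_mem a x)%:Z.

Definition gessel_cond (x : seq letter) : bool :=
  (0 <= N L2 x - N L2b x) && (0 <= N L2 x + N L1 x - N L2b x - N L1b x).

(* The prefixes of [w] are the [take i w] with [i <= size w]; see [gesselP]. *)
Definition gessel (w : seq letter) : bool :=
  all (fun i => gessel_cond (take i w)) (iota 0 (size w).+1).

Lemma gesselP (w : seq letter) :
  reflect (forall x, prefix x w -> gessel_cond x) (gessel w).
Proof.
apply: (iffP allP) => [gw x /prefixP[y def_w]|gw i _].
  rewrite -(take_size_cat y (erefl (size x))) -def_w; apply: gw.
  by rewrite mem_iota add0n /= ltnS def_w size_cat leq_addr.
exact/gw/prefix_take.
Qed.

Definition complete_gessel (w : seq letter) : bool :=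
  [&& gessel w, N L1 w == N L1b w & N L2 w == N L2b w].

Definition G1 (n : nat) : nat :=
  #|[set w : (2 * n).-tuple letter |
       [&& complete_gessel w, N L1 w == 1 & N L1b w == 1]]|.

(* Main.v *)
Require Import Defs.
From HB Require Import structures.
From mathcomp Require Import all_boot all_order all_algebra.
From mathcomp Require Import zify ring lra.
Import GRing.Theory Num.Theory.
Local Open Scope ring_scope.

(** Deleting the last letter of a Gessel word leaves a Gessel word, and whether
    a letter may be appended depends only on the resulting numbers [a], [b],
    [i], [j] of letters [1], [1bar], [2], [2bar].  So the number of Gessel words
    with a given content satisfies a first-order recurrence on the region
    [j <= i], [j + b <= i + a], and vanishes outside it.

    Each closed form below also vanishes just outside this region, like the
    count itself, so that Pascal's rule verifies the recurrence with no case
    distinction at its edge.  For [a = b = 1] and [i = j = n - 1] the formula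
    contains the sum of the [C(2n - 1, k)] for [k < n - 1]: half a row of
    Pascal's triangle, which is [2 ^ (2n - 2)], less its middle term. *)

Lemma bin_add_sym i j : 'C(i + j, i) = 'C(i + j, j).
Proof. by rewrite -[in RHS]bin_sub ?leq_addl // addnK. Qed.

Lemma bin_central p : 'C(p.*2.+2, p.+1) = (2 * 'C(p.*2.+1, p))%N.
Proof. by rewrite binS -addnn -addSn bin_add_sym mul2n addnn. Qed.

Lemma natr_binS (R : pzSemiRingType) n k :
  'C(n.+1, k.+1)%:R = 'C(n, k.+1)%:R + 'C(n, k)%:R :> R.
Proof. by rewrite binS natrD. Qed.

Lemma sum_binS n m :
  (\sum_(k < m.+1) 'C(n.+1, k) = 2 * \sum_(k < m) 'C(n, k) + 'C(n, m))%N.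
Proof.
elim: m => [|m IHm]; first by rewrite big_ord_recr !big_ord0 !bin0.
by rewrite big_ord_recr IHm [in RHS]big_ord_recr /= binS; lia.
Qed.

Lemma sum_bin_half p : (\sum_(k < p.+1) 'C(p.*2.+1, k) = 2 ^ p.*2)%N.
Proof.
elim: p => [|p IHp]; first by rewrite big_ord_recr big_ord0 bin0.
rewrite doubleS sum_binS bin_central sum_binS !expnS -IHp.
by rewrite big_ord_recr /=; lia.
Qed.

Lemma triangle_ind (P : nat -> nat -> Prop) :
    P 0%N 0%N -> (forall i, P i 0%N -> P i.+1 0%N) -> (forall i, P i i.+1) ->
    (forall i j, (j <= i)%N -> P i j.+1 -> P i.+1 j -> P i.+1 j.+1) ->
  forall i j, (j <= i.+1)%N -> P i j.
Proof.
move=> P00 Pi0 Pdiag Pstep; elim=> [|i IHi]; elim=> [|j IHj] // le_j.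
- by case: j IHj le_j => // _ _; apply: Pdiag.
- exact/Pi0/IHi.
- move: le_j; rewrite ltnS leq_eqVlt => /predU1P[->|lt_ji].
    exact: Pdiag.
  by apply: Pstep => //; [apply: IHi | apply/IHj/ltnW/ltnW].
Qed.

Lemma card_tuple_rcons (T : finType) (l : nat) (P : pred (seq T)) :
  #|[set w : l.+1.-tuple T | P w]| =
  (\sum_x #|[set w : l.-tuple T | P (rcons w x)]|)%N.
Proof.
pose append (xw : T * l.-tuple T) := rcons_tuple xw.2 xw.1.
have append_bij : bijective append.
  apply: inj_card_bij => [[x w] [y v] /(congr1 val)/eqP|]; last first.
    by rewrite card_prod !card_tuple expnS.
  by rewrite /= eqseq_rcons => /andP[/eqP/val_inj-> /eqP->].
rewrite -sum1dep_card (reindex append) /=; last exact: onW_bij.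
under [RHS]eq_bigr do rewrite -sum1dep_card.
by rewrite pair_big_dep.
Qed.

Lemma sum_letter (F : letter -> nat) :
  (\sum_x F x = F L1 + F L1b + F L2 + F L2b)%N.
Proof.
rewrite (bigD1 L1) // (bigD1 L1b) // (bigD1 L2) // (bigD1 L2b) //= big_pred0.
  by rewrite addn0 !addnA.
by case.
Qed.

Lemma size_count_letter (w : seq letter) :
  size w =
  (count_mem L1 w + count_mem L1b w + count_mem L2 w + count_mem L2b w)%N.
Proof. by elim: w => //= -[] w -> /=; lia. Qed.

Lemma gesselW w : gessel w -> gessel_cond w.
Proof. by move/gesselP; apply; apply: prefix_refl. Qed.

Lemma gessel_rcons w x :
  gessel (rcons w x) = gessel w && gessel_cond (rcons w x).
Proof.
rewrite /gessel size_rcons -addn1 iotaD all_cat.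
congr (_ && _); last by rewrite /= andbT take_oversize ?size_rcons.
apply: eq_in_all => i; rewrite mem_iota ltnS => /= le_iw.
by rewrite -cats1 takel_cat.
Qed.

Definition gessel_content (a b i j : nat) (w : seq letter) : bool :=
  [&& gessel w, count_mem L1 w == a, count_mem L1b w == b,
      count_mem L2 w == i & count_mem L2b w == j].

Lemma gessel_content_rcons a b i j w x : (j <= i)%N -> (j + b <= i + a)%N ->
  gessel_content a b i j (rcons w x) =
  match x with
  | L1 => (0 < a)%N && gessel_content a.-1 b i j w
  | L1b => (0 < b)%N && gessel_content a b.-1 i j w
  | L2 => (0 < i)%N && gessel_content a b i.-1 j w
  | L2b => (0 < j)%N && gessel_content a b i j.-1 w
  end.
Proof.
move=> le_ji le_jb_ia; rewrite /gessel_content gessel_rcons.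
case: (gessel w); last by case: x; rewrite /= ?andbF.
by rewrite /gessel_cond /N -!cats1 !count_cat; case: x => /=; lia.
Qed.

Definition num_gessel (a b i j : nat) : nat :=
  #|[set w : (a + b + i + j).-tuple letter | gessel_content a b i j w]|.

Lemma num_gessel_eq0 a b i j :
  ~~ ((j <= i) && (j + b <= i + a))%N -> num_gessel a b i j = 0%N.
Proof.
move=> ineq; apply: eq_card0 => w; rewrite inE; apply: contraNF ineq.
by case/and5P=> /gesselW; rewrite /gessel_cond /N; lia.
Qed.

Lemma num_gessel0 : num_gessel 0 0 0 0 = 1%N.
Proof.
rewrite /num_gessel (@eq_card1 _ [tuple]) // => w.
by rewrite !inE tuple0 eqxx.
Qed.

Lemma num_gessel_rec a b i j :
    (j <= i)%N -> (j + b <= i + a)%N -> (0 < a + b + i + j)%N ->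
  num_gessel a b i j =
  ((if 0 < a then num_gessel a.-1 b i j else 0) +
   (if 0 < b then num_gessel a b.-1 i j else 0) +
   (if 0 < i then num_gessel a b i.-1 j else 0) +
   (if 0 < j then num_gessel a b i j.-1 else 0))%N.
Proof.
move=> le_ji le_jb_ia; rewrite {1}/num_gessel.
case def_l: (a + b + i + j)%N => [//|l] _; rewrite card_tuple_rcons sum_letter.
have card_shorter (c : bool) a' b' i' j' :
    (c -> l = a' + b' + i' + j')%N ->
  #|[set w : l.-tuple letter | c && gessel_content a' b' i' j' w]| =
  if c then num_gessel a' b' i' j' else 0%N.
  by case: c => [/(_ isT)->|_] //; apply: eq_card0 => w; rewrite inE.
by congr (_ + _ + _ + _)%N; rewrite -card_shorter; try lia;
  apply: eq_card => w; rewrite !inE gessel_content_rcons.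
Qed.

(* In the absence of [1bar] the second Gessel condition follows from the first,
   so the letters [1] can be inserted anywhere. *)
Lemma num_gessel_ones a i j :
  num_gessel a 0 i j = ('C(i + j + a, a) * num_gessel 0 0 i j)%N.
Proof.
have [n] := ubnP (i + j + a); elim: n a i j => // n IHn a i j le_n.
have [lt_ij|le_ji] := ltnP i j; first by rewrite !num_gessel_eq0 ?muln0 //; lia.
case: a le_n => [|a] le_n; first by rewrite bin0 mul1n.
rewrite num_gessel_rec /=; try lia.
rewrite (IHn a i j); last lia.
rewrite [in RHS]addnS binS mulnDl.
case: i le_ji le_n => [|i] le_ji le_n.
  by have -> : j = 0%N by [lia]; rewrite (@bin_small _ a.+1) /=; lia.
rewrite (num_gessel_rec 0 0 i.+1) /= ?(IHn a.+1 i j); try lia.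
case: j le_ji le_n => [|j] le_ji le_n /=; first by rewrite !addn0 addSnnS; lia.
by rewrite (IHn a.+1 i.+1 j) ?addnS ?addSn; lia.
Qed.

Lemma num_gessel_ballot i j : (j <= i.+1)%N ->
  (num_gessel 0 0 i j)%:R = 'C(i + j, j)%:R - 'C(i + j, i.+1)%:R :> rat.
Proof.
move: i j; apply: triangle_ind => [|i|i|i j le_ji].
- by rewrite num_gessel0.
- rewrite !addn0 !bin0 !bin_small // => IHi.
  by rewrite num_gessel_rec //= addn0.
- by rewrite num_gessel_eq0 ?subrr //; lia.
- move=> IHl IHr; rewrite num_gessel_rec //=; last lia.
  by rewrite natrD IHl IHr !addSn !addnS !(natr_binS _ (i + j).+1); ring.
Qed.

Lemma num_gessel_one i j : (j <= i.+1)%N ->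
  (num_gessel 1 0 i j)%:R = (i.+1%:R - j%:R) * 'C((i + j).+1, j)%:R :> rat.
Proof.
move=> le_ji; rewrite num_gessel_ones bin1 natrM num_gessel_ballot // mulrBr.
rewrite -!natrM addn1 !(mul_bin_down (i + j).+1).
by rewrite -[(i + j).+1]addSn bin_add_sym addnK addKn !natrM; ring.
Qed.

Lemma num_gessel_onebar i j : (j <= i.+1)%N ->
  (num_gessel 0 1 i.+1 j)%:R = (i.+1%:R - j%:R) * 'C((i + j).+2, j)%:R :> rat.
Proof.
move: i j; apply: triangle_ind => [|i|i|i j le_ji].
- rewrite num_gessel_rec //= add0n addn0 natrD num_gessel_ballot //.
  by rewrite num_gessel_eq0.
- rewrite !bin0 => IHi.
  rewrite num_gessel_rec //= add0n addn0 natrD IHi num_gessel_ballot // !addn0.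
  by rewrite bin0 bin_small // -!natr1; ring.
- by rewrite num_gessel_eq0 ?subrr ?mul0r //; lia.
- move=> IHl IHr; rewrite num_gessel_rec //= ?add0n; try lia.
  rewrite natrD IHr natrD IHl num_gessel_ballot; last lia.
  have -> : 'C(i.+2 + j.+1, i.+3) = 'C(i.+2 + j.+1, j).
    by rewrite -addSnnS bin_add_sym.
  by rewrite !addSn !addnS !(natr_binS _ (i + j).+3) -!natr1; ring.
Qed.

Lemma num_gessel_one_onebar i j : (j <= i.+1)%N ->
  (num_gessel 1 1 i j)%:R =
  (i.+1%:R - j%:R) * ((i + j).+1%:R * 'C((i + j).+1, j)%:R -
                      2 * (\sum_(k < j) 'C((i + j).+1, k))%:R) :> rat.
Proof.
move: i j; apply: triangle_ind => [|i|i|i j le_ji].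
- rewrite num_gessel_rec //= !addn0 natrD num_gessel_one // num_gessel_eq0 //.
  by rewrite big_ord0.
- rewrite !bin0 !big_ord0 !addn0 => IHi.
  rewrite num_gessel_rec //= addn0 natrD IHi natrD.
  rewrite num_gessel_one // num_gessel_onebar //.
  by rewrite !bin0 -!natr1; ring.
- by rewrite num_gessel_eq0 ?subrr ?mul0r //; lia.
- move=> IHl IHr; rewrite num_gessel_rec //=; try lia.
  rewrite natrD IHr natrD IHl natrD num_gessel_one ?num_gessel_onebar; try lia.
  rewrite !addSn !addnS (sum_binS (i + j).+2) big_ord_recr /=.
  rewrite !(natr_binS _ (i + j).+2).
  have bin_ratio : j.+1%:R * 'C((i + j).+2, j.+1)%:R =
      i.+2%:R * 'C((i + j).+2, j)%:R :> rat.
    by rewrite -!natrM mul_bin_left; congr (_ * _)%:R; lia.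
  move: bin_ratio; move: 'C(_, j.+1) 'C(_, j) (\sum_(_ < _) _)%N => y x X.
  rewrite -!natr1 natrD (natrD _ X) (natrD _ (2 * X)) natrM => bin_ratio.
  by lra.
Qed.

Lemma G1_num_gessel p : G1 p.+1 = num_gessel 1 1 p p.
Proof.
rewrite /num_gessel (_ : (1 + 1 + p + p = 2 * p.+1)%N); last lia.
apply: eq_card => w; rewrite !inE /gessel_content /complete_gessel /N.
case: w => w /= /eqP; rewrite size_count_letter.
by case: gessel => //=; lia.
Qed.

Theorem theorem2p5 (n : nat) (n_gt0 : (0 < n)%N) :
  (G1 n)%:R = (2 * n + 1)%:R / 2 * 'C(2 * n, n)%:R - 2 ^+ (2 * n - 1) :> rat.
Proof.
case: n n_gt0 => // p _; rewrite G1_num_gessel num_gessel_one_onebar //.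
rewrite mul2n addnn doubleS bin_central subn1 /=.
have half := sum_bin_half p; rewrite big_ord_recr /= in half.
by rewrite exprS -natrX -half natrD natrM -mul2n; field.
Qed.
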